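(* Let $A\in\mathbb{R}^{n\times n}$ be symmetric, $B\in\mathbb{R}^{n\times n}$ symmetric with $B\succeq0$, $\alpha>0$, and $c,f\in\mathbb{R}^n$. If $(\bar\varsigma,\bar\sigma_1)\in S^+_{\varsigma\sigma_1}$ is a critical point of $\Pi^g(\varsigma,\sigma_1)$, then the vector $$(\bar x,\bar v)=\left(G(\bar\varsigma,\bar\sigma_1)^{-1}c,\ \delta(f+\bar\sigma_1)^+\right)$$ is a global minimum point of $(\mathcal{P}_b)$.
   Context: Primal problem $(\mathcal{P}_b)$: minimize $P(x,v)=\frac12x^TAx-c^Tx+\frac12\left(\frac12x^TBx-\alpha\right)^2-f^Tv$ over $\chi_v=\{(x,v)\in\mathbb{R}^n\times\{0,1\}^n : -v\le x\le v\}$ (vector inequalities componentwise). For $\varsigma\in\mathbb{R}$, $\sigma_1\in\mathbb{R}^n$ put $G(\varsigma,\sigma_1)=A+\varsigma B+2\,\mathrm{Diag}(\sigma_1)$, where $\mathrm{Diag}(s)$ is the diagonal matrix with diagonal $s$. $S^+_{\varsigma\sigma_1}=\{(\varsigma,\sigma_1)\in\mathbb{R}\times\mathbb{R}^n : \varsigma\ge-\alpha,\ \sigma_1\ge0,\ G(\varsigma,\sigma_1)\succ0,\ f_i+(\sigma_1)_i\ne0\ \text{for all } i=1,\dots,n\}$. $$\Pi^g(\varsigma,\sigma_1)=-\tfrac12c^TG(\varsigma,\sigma_1)^{-1}c-\sum_{i=1}^n\left(f_i+(\sigma_1)_i\right)^+-\tfrac12\varsigma^2-\alpha\varsigma,\qquad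 s^+=\max(s,0).$$ This is differentiable near points of $S^+_{\varsigma\sigma_1}$; a critical point is a point where its gradient with respect to $(\varsigma,\sigma_1)$ vanishes. For $t\in\mathbb{R}^n$ with all $t_i\ne0$, $\delta(t)^+\in\mathbb{R}^n$ is the vector with $i$-th component $1$ if $t_i>0$ and $0$ if $t_i<0$. *)

(* Defs.v *)
From HB Require Import structures.
From mathcomp Require Import all_boot all_order all_algebra.
From mathcomp Require Import all_classical all_reals all_analysis.

Set Implicit Arguments.
Unset Strict Implicit.
Unset Printing Implicit Defensive.

Import Order.TTheory GRing.Theory Num.Theory.
Import numFieldNormedType.Exports.

Local Open Scope classical_set_scope.
Local Open Scope ring_scope.

Definition dot (R : realType) (n : nat) (u v : 'cV[R]_n) : R :=
  (u^T *m v) 0 0.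

Definition quad (R : realType) (n : nat) (M : 'M[R]_n) (x : 'cV[R]_n) : R :=
  (x^T *m M *m x) 0 0.

Definition psd (R : realType) (n : nat) (M : 'M[R]_n) : Prop :=
  M^T = M /\ forall x : 'cV[R]_n, 0 <= quad M x.

Definition posdef (R : realType) (n : nat) (M : 'M[R]_n) : Prop :=
  M^T = M /\ forall x : 'cV[R]_n, x != 0 -> 0 < quad M x.

Definition primal (R : realType) (n : nat) (A B : 'M[R]_n) (alpha : R)
    (c f : 'cV[R]_n) (z : 'cV[R]_n * 'cV[R]_n) : R :=
  let: (x, v) := z in
  2^-1 * quad A x - dot c x + 2^-1 * (2^-1 * quad B x - alpha) ^+ 2 - dot f v.

Definition chi (R : realType) (n : nat) : set ('cV[R]_n * 'cV[R]_n) :=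
  [set z : 'cV[R]_n * 'cV[R]_n | forall i : 'I_n,
     (z.2 i 0 = 0 \/ z.2 i 0 = 1) /\ - z.2 i 0 <= z.1 i 0 <= z.2 i 0].

Definition global_minimum_point (T : Type) (R : realType) (F : T -> R)
    (D : set T) (z : T) : Prop :=
  D z /\ forall w, D w -> F z <= F w.

Definition G (R : realType) (n : nat) (A B : 'M[R]_n)
    (vs : R) (s : 'cV[R]_n) : 'M[R]_n :=
  A + vs *: B + 2 *: diag_mx s^T.

Definition Splus (R : realType) (n : nat) (A B : 'M[R]_n) (alpha : R)
    (f : 'cV[R]_n) : set (R * 'cV[R]_n) :=
  [set p : R * 'cV[R]_n | [/\ - alpha <= p.1,
               forall i : 'I_n, 0 <= p.2 i 0,
               posdef (G A B p.1 p.2) &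
               forall i : 'I_n, f i 0 + p.2 i 0 != 0]].

Definition pospart (R : realType) (s : R) : R := Num.max s 0.

Definition Pig (R : realType) (n : nat) (A B : 'M[R]_n) (alpha : R)
    (c f : 'cV[R]_n) (p : R * 'cV[R]_n) : R :=
  let: (vs, s) := p in
  - (2^-1 * quad (invmx (G A B vs s)) c)
  - \sum_(i < n) pospart (f i 0 + s i 0)
  - 2^-1 * vs ^+ 2 - alpha * vs.

(* The vector of partial derivatives. ['D_v F p] is a total operator, so
   [critical_point] carries no differentiability hypothesis; it has its usual
   meaning where F is differentiable, as [Pig] is at the points of [Splus]. *)
Definition gradient (R : realType) (n : nat) (F : R * 'cV[R]_n -> R)
    (p : R * 'cV[R]_n) : R * 'cV[R]_n :=
  ('D_(1, 0) F p, \col_(i < n) 'D_(0, delta_mx i 0) F p).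

Definition critical_point (R : realType) (n : nat) (F : R * 'cV[R]_n -> R)
    (p : R * 'cV[R]_n) : Prop :=
  gradient F p = 0.

(* Only meaningful when no entry of t vanishes; a zero entry is sent to 0. *)
Definition deltap (R : realType) (n : nat) (t : 'cV[R]_n) : 'cV[R]_n :=
  \col_(i < n) (if 0 < t i 0 then 1 else 0).

(* Main.v *)
(* At a point of Splus, with x = G^-1 c and v = deltap (f + s), the partial
   derivatives of Pig are x^T B x / 2 - alpha - vs and x_i^2 - v_i, so a critical
   point gives x_i^2 = v_i in {0, 1}, hence feasibility.  On chi the primal
   dominates the convex quadratic y^T G y / 2 - c^T y plus terms in w minimized by
   v: replace t^2 / 2 by its tangent vs * t - vs^2 / 2 at t = vs, and use
   y_i^2 <= w_i with the multiplier s_i >= 0.  All these bounds are equalities at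
   (x, v). *)
Require Import Defs.
From mathcomp Require Import all_boot all_order all_algebra.
From mathcomp Require Import all_classical all_reals all_analysis.
From mathcomp Require Import ring lra.
Set Implicit Arguments.
Unset Strict Implicit.
Unset Printing Implicit Defensive.
Import Order.TTheory GRing.Theory Num.Theory.
Import numFieldNormedType.Exports.
Local Open Scope ring_scope.

(** Evaluation at [h] is a ring morphism, so it commutes with determinants and adjugates. Along a
    line of matrices these are thus polynomial in [h], and their limits at 0 follow from continuity
    of polynomials. *)
Lemma map_horner_pencil (R : comNzRingType) (n : nat) (M N : 'M[R]_n) h :
  map_mx (horner_eval h) (map_mx polyC M + 'X *: map_mx polyC N) = M + h *: N.
Proof.
by apply/matrixP => i j; rewrite !mxE /= /horner_eval !hornerE.
Qed.

Lemma horner_det_pencil (R : comNzRingType) (n : nat) (M N : 'M[R]_n) :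
  exists p : {poly R}, forall h, \det (M + h *: N) = p.[h].
Proof.
exists (\det (map_mx polyC M + 'X *: map_mx polyC N)) => h.
by rewrite -map_horner_pencil det_map_mx.
Qed.

Lemma horner_adj_pencil (R : comNzRingType) (n : nat) (M N : 'M[R]_n)
    (u : 'rV[R]_n) (w : 'cV[R]_n) :
  exists p : {poly R}, forall h, (u *m \adj (M + h *: N) *m w) 0 0 = p.[h].
Proof.
pose P := map_mx polyC u *m \adj (map_mx polyC M + 'X *: map_mx polyC N) *m
          map_mx polyC w.
exists (P 0 0) => h; have -> : (P 0 0).[h] = map_mx (horner_eval h) P 0 0
  by rewrite [RHS]mxE.
have evalC m k (X : 'M[R]_(m, k)) : map_mx (horner_eval h) (map_mx polyC X) = X.
  by apply/matrixP => i j; rewrite !mxE /= /horner_eval hornerC.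
by rewrite !map_mxM map_mx_adj map_horner_pencil !evalC.
Qed.

Lemma invmxB (R : comUnitRingType) (n : nat) (M N : 'M[R]_n) :
  M \in unitmx -> N \in unitmx ->
  invmx M - invmx N = invmx M *m (N - M) *m invmx N.
Proof.
by move=> uM uN; rewrite mulmxBr mulmxBl mulVmx // mul1mx -mulmxA mulmxV // mulmx1.
Qed.

Lemma quadD (R : realType) n (M N : 'M[R]_n) x :
  quad (M + N) x = quad M x + quad N x.
Proof. by rewrite /quad mulmxDr mulmxDl mxE. Qed.

Lemma quadZ (R : realType) n a (M : 'M[R]_n) x : quad (a *: M) x = a * quad M x.
Proof. by rewrite /quad -scalemxAr -scalemxAl mxE. Qed.

Lemma quad_diag (R : realType) n (d x : 'cV[R]_n) :
  quad (diag_mx d^T) x = \sum_i d i 0 * x i 0 ^+ 2.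
Proof.
rewrite /quad mul_mx_diag mxE; apply: eq_bigr => i _.
by rewrite !mxE expr2; ring.
Qed.

Lemma quad_G (R : realType) n (A B : 'M[R]_n) vs s x :
  quad (G A B vs s) x =
    quad A x + vs * quad B x + 2 * \sum_i s i 0 * x i 0 ^+ 2.
Proof. by rewrite /G !quadD !quadZ quad_diag. Qed.

(** [G] is affine in [(vs, s)]; its linear part is [G] with [A] set to 0, so [quad_G] also applies
    to the increment. *)
Lemma G_pencil (R : realType) n (A B : 'M[R]_n) vs s a d h :
  G A B (h * a + vs) (h *: d + s) = G A B vs s + h *: G 0 B a d.
Proof.
by apply/matrixP => i j; rewrite !mxE; case: (i == j); rewrite ?mulr1n ?mulr0n; ring.
Qed.

Lemma dotE (R : realType) n (u v : 'cV[R]_n) : dot u v = \sum_i u i 0 * v i 0.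
Proof. by rewrite /dot mxE; apply: eq_bigr => i _; rewrite mxE. Qed.

(** A nonzero row [v] with [v *m M = 0] would give [quad M v^T = 0]. *)
Lemma posdef_unit (R : realType) n (M : 'M[R]_n) : posdef M -> M \in unitmx.
Proof.
case=> _ posM; rewrite -row_free_unit; apply: inj_row_free => v vM0.
apply: contrapT => /eqP v0.
have /posM : v^T != 0 by rewrite -[0]trmx0 (inj_eq (@trmx_inj _ _ _)).
by rewrite /quad trmxK vM0 mul0mx mxE ltxx.
Qed.

(** Completing the square: with [x = invmx M *m c], the two sides differ by half of
    [quad M (y - x)]. *)
Lemma posdef_quad_min (R : realType) n (M : 'M[R]_n) (c y : 'cV[R]_n) :
  posdef M ->
  2^-1 * quad M (invmx M *m c) - dot c (invmx M *m c) <=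
  2^-1 * quad M y - dot c y.
Proof.
move=> pM; have uM := posdef_unit pM; case: pM => MT posM.
set x := invmx M *m c.
have Mx : M *m x = c by rewrite mulKVmx.
have xM : x^T *m M = c^T by rewrite -{1}MT -trmx_mul Mx.
have : 0 <= quad M (y - x).
  by have [->|/posM/ltW//] := eqVneq (y - x) 0; rewrite /quad mulmx0 mxE.
have dC (u v : 'cV[R]_n) : dot u v = dot v u.
  by rewrite !dotE; apply: eq_bigr => i _; rewrite mulrC.
have qx : quad M x = dot c x by rewrite /quad xM.
have -> : quad M (y - x) = quad M y - 2 * dot c y + dot c x.
  rewrite /quad [(y - x)^T]linearB /= !mulmxBl !mulmxBr xM -[y^T *m M *m x]mulmxA Mx.
  have sE (X Y : 'M[R]_1) : (X - Y) 0 0 = X 0 0 - Y 0 0 by rewrite !mxE.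
  by rewrite !sE -!/(dot _ _) (dC y c) -/(quad M y); ring.
by rewrite qx; lra.
Qed.

Local Open Scope classical_set_scope.

(** Away from its kink at 0, [pospart] is locally affine, so the increment is exact and leaves no
    remainder. *)
Lemma pospart_near (R : realType) (t d : R) : t != 0 ->
  \forall h \near 0, pospart (t + h * d) - pospart t =
                     h * d * (if 0 < t then 1 else 0).
Proof.
move=> t0.
have cv : t + h * d @[h --> (0 : R)] --> t.
  rewrite -[X in _ --> X]addr0 -[X in _ + X](mul0r d).
  by apply: cvgD; [exact: cvg_cst|apply: cvgM; [exact: cvg_id|exact: cvg_cst]].
case: (ltgtP t 0) t0 => // [tn|tp] _.
- near=> h.
  have th : t + h * d < 0 by near: h; exact: cvgr_lt cv _ tn.
  by rewrite /pospart !max_r ?ltW // subrr mulr0.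
- near=> h.
  have th : 0 < t + h * d by near: h; exact: cvgr_gt cv _ tp.
  by rewrite /pospart !max_l ?ltW // mulr1; ring.
Unshelve. all: by end_near.
Qed.

(* The resolvent identity turns the difference quotient into minus the ratio of
   two polynomials in h, c^T adj(M + h N) N M^-1 c over det(M + h N). *)
Lemma quad_invmx_cvg (R : realType) n (M N : 'M[R]_n) (c : 'cV[R]_n) :
  M^T = M -> M \in unitmx ->
  h^-1 * (quad (invmx (M + h *: N)) c - quad (invmx M) c) @[h --> 0^']
    --> - quad N (invmx M *m c).
Proof.
move=> MT uM; set x := invmx M *m c.
have [p pE] := horner_det_pencil M N.
have [q qE] := horner_adj_pencil M N c^T (N *m x).
have p0 : p.[0] = \det M by rewrite -pE scale0r addr0.
have detM : \det M != 0 by rewrite -unitfE -unitmxE.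
have pn0 : \forall h \near 0^', p.[h] != 0.
  apply: nbhs_dnbhs; have cp := @continuous_horner R p 0.
  by apply: cvgr_neq0 cp _; rewrite p0.
(* Symmetry of [M] turns [x^T] into [c^T *m invmx M], and [invmx M] is the adjugate divided by the
   determinant. *)
have lim0 : - (p.[0]^-1 * q.[0]) = - quad N x.
  rewrite p0 -qE scale0r addr0 /quad.
  have -> : x^T *m N *m x = c^T *m invmx M *m (N *m x).
    by rewrite /x trmx_mul trmx_inv MT !mulmxA.
  by rewrite [in RHS]/invmx uM -scalemxAr -scalemxAl [X in _ = - X]mxE.
rewrite -lim0.
suff H : \forall h \near 0^', - (p.[h]^-1 * q.[h]) =
    h^-1 * (quad (invmx (M + h *: N)) c - quad (invmx M) c).
  apply: cvg_trans (near_eq_cvg H) _.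
  apply: cvgN; apply: cvgM; [apply: cvgV; first by rewrite p0|].
    by apply: cvg_within_filter; exact: continuous_horner.
  by apply: cvg_within_filter; exact: continuous_horner.
near=> h.
have h0 : h != 0 by near: h; exact: nbhs_dnbhs_neq.
have ph : p.[h] != 0 by near: h.
have uH : M + h *: N \in unitmx by rewrite unitmxE pE unitfE.
have -> : quad (invmx (M + h *: N)) c - quad (invmx M) c =
          (c^T *m (invmx (M + h *: N) - invmx M) *m c) 0 0.
  by rewrite /quad mulmxBr mulmxBl [RHS]mxE [X in _ = _ + X]mxE.
have -> : invmx (M + h *: N) - invmx M =
          (- h * p.[h]^-1) *: (\adj (M + h *: N) *m N *m invmx M).
  rewrite invmxB // opprD addrA subrr add0r {1}/invmx uH pE -scaleNr.
  by rewrite -scalemxAr -!scalemxAl scalerA.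
rewrite -scalemxAr -scalemxAl [X in _ = _ * X]mxE -qE /x !mulmxA.
by field; rewrite ph h0.
Unshelve. all: by end_near.
Qed.

(** A general direction [(a, d)] covers both components of [gradient] with a single limit. *)
Lemma derive_Pig (R : realType) n (A B : 'M[R]_n) alpha c f vs s (a : R)
    (d : 'cV[R]_n) :
  Splus A B alpha f (vs, s) ->
  let x := invmx (G A B vs s) *m c in
  'D_(a, d) (Pig A B alpha c f) (vs, s) =
    a * (2^-1 * quad B x - alpha - vs) +
    \sum_i d i 0 * (x i 0 ^+ 2 - deltap (f + s) i 0).
Proof.
move=> + x; case=> [/=] _ _ pG fs0; have uG := posdef_unit pG; have GT := pG.1.
pose v := deltap (f + s).
have Q := quad_invmx_cvg (N := G 0 B a d) (c := c) GT uG.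
rewrite /derive; apply: cvg_lim => //.
(* The expanded difference quotient: the resolvent part, the terms constant in [h], and the
   remainder left by [vs ^+ 2]. *)
pose L h := - 2^-1 * (h^-1 * (quad (invmx (G A B vs s + h *: G 0 B a d)) c -
                 quad (invmx (G A B vs s)) c))
  - (\sum_i d i 0 * v i 0 + vs * a + alpha * a) - 2^-1 * a ^+ 2 * h.
have H : \forall h \near 0^',
    L h = h^-1 *: ((Pig A B alpha c f \o shift (vs, s)) (h *: (a, d))
                   - Pig A B alpha c f (vs, s)).
  have pp : \forall h \near 0^', forall i : 'I_n,
      pospart (f i 0 + s i 0 + h * d i 0) - pospart (f i 0 + s i 0) =
      h * d i 0 * v i 0.
    apply: filter_forall => i; apply: nbhs_dnbhs.
    by rewrite !mxE; exact: pospart_near.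
  near=> h.
  have h0 : h != 0 by near: h; exact: nbhs_dnbhs_neq.
  have ph : forall i : 'I_n, pospart (f i 0 + s i 0 + h * d i 0)
      - pospart (f i 0 + s i 0) = h * d i 0 * v i 0 by near: h.
  rewrite /L /= -[h *: a]/(h * a) G_pencil.
  have -> : \sum_(i < n) pospart (f i 0 + (h *: d + s) i 0) =
      \sum_(i < n) pospart (f i 0 + s i 0) + h * \sum_i d i 0 * v i 0.
    rewrite mulr_sumr -big_split; apply: eq_bigr => i _ /=.
    by rewrite mulrA -ph [RHS]addrC subrK !mxE -addrA [s i 0 + _]addrC.
  by rewrite -[RHS]/(h^-1 * _); field; rewrite h0.
apply: cvg_trans (near_eq_cvg H) _.
have -> : a * (2^-1 * quad B x - alpha - vs) +
    \sum_i d i 0 * (x i 0 ^+ 2 - deltap (f + s) i 0) =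
  - 2^-1 * (- quad (G 0 B a d) x)
  - (\sum_i d i 0 * v i 0 + vs * a + alpha * a) - 2^-1 * a ^+ 2 * 0.
  under eq_bigr do rewrite mulrBr.
  have q0 : quad 0 x = 0 by rewrite /quad mulmx0 mul0mx mxE.
  by rewrite sumrB quad_G q0 -/v; field.
apply: cvgB; [apply: cvgB; [|exact: cvg_cst]|].
  by apply: cvgM; [exact: cvg_cst|].
apply: cvgM; [exact: cvg_cst|].
exact: cvg_within.
Unshelve. all: by end_near.
Qed.

Theorem theorem4 (R : realType) (n : nat) (A B : 'M[R]_n) (alpha : R)
    (c f : 'cV[R]_n) (vs : R) (s : 'cV[R]_n)
    (hA : A^T = A) (hB : psd B) (halpha : 0 < alpha)
    (hS : Splus A B alpha f (vs, s))
    (hcrit : critical_point (Pig A B alpha c f) (vs, s)) :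
  global_minimum_point (primal A B alpha c f) (@chi R n)
    (invmx (G A B vs s) *m c, deltap (f + s)).
Proof.
have [/= _ s_ge0 pG fs0] := hS.
move: hcrit; rewrite /critical_point /gradient.
set x := invmx _ *m c; set v := deltap _ => -[].
rewrite derive_Pig // -/x big1 ?addr0 ?mul1r => [|i _]; last by rewrite mxE mul0r.
move=> /eqP; rewrite subr_eq0 => /eqP vsE /matrixP crit.
have vE i : x i 0 ^+ 2 = v i 0.
  have := crit i 0; rewrite !mxE derive_Pig // -/x -/v mul0r add0r.
  rewrite (bigD1 i) //= big1 ?addr0 => [|j /negbTE ji]; last first.
    by rewrite !mxE ji mul0r.
  by rewrite !mxE !eqxx mul1r => /eqP; rewrite subr_eq0 => /eqP.
have v01 i : v i 0 = 0 \/ v i 0 = 1 by rewrite mxE; case: ifP; [right|left].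
split=> [i /=|[y w] yw].
  split=> //; have := vE i; case: (v01 i) => ->.
    by move=> /eqP; rewrite sqrf_eq0 => /eqP ->; rewrite oppr0 lexx.
  by move=> /eqP; rewrite sqrf_eq1 => /orP[] /eqP ->; lra.
have := posdef_quad_min c y pG; rewrite -/x !quad_G /primal.
(* Termwise, the left side is at most [(f i 0 + s i 0) * w i 0], hence at most
   [pospart (f i 0 + s i 0)], which is the right-hand term because [x i 0 ^+ 2 = v i 0]. *)
have : dot f w + \sum_i s i 0 * y i 0 ^+ 2 <= dot f v + \sum_i s i 0 * x i 0 ^+ 2.
  rewrite !dotE -!big_split; apply: ler_sum => i _ /=; rewrite vE.
  have [/= w01 /andP[yl yr]] := yw i.
  have yw2 : y i 0 ^+ 2 <= w i 0 by case: w01 yl yr => ->; nra.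
  have := ler_wpM2l (s_ge0 i) yw2; have := fs0 i.
  rewrite ![v i 0]mxE ![(f + s) i 0]mxE /=.
  by case: w01 => /= ->; case: (ltgtP (f i 0 + s i 0) 0) => // ? _; lra.
(* This square is the tangent-line bound. Half of it, added to the two preceding inequalities, gives
   the claim once [vs] is expressed through [quad B x]. *)
have := sqr_ge0 (2^-1 * quad B y - alpha - vs).
rewrite -vsE; nra.
Qed.
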